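(* Every DMGrp-space $X$ is homeomorphic to $\mathcal{F}_0(\mathcal{G}_0(X))$, the prime spectrum of the algebra of compact open subsets of $X$.
   Context: For a topological space $X$, $\Omega(X)$ is the set of compact open subsets of $X$, and the specialization order is: $x\leqslant y$ iff every open set containing $x$ contains $y$. A spectral space is a compact, $T_0$, sober space $X$ such that $\Omega(X)$ is closed under finite intersections and is a basis for $X$ (sober: every completely prime filter of the lattice of open sets is the set of open neighbourhoods of some point). A De Morgan spectral space is $\langle X;g,\tau\rangle$ where $\langle X;\tau\rangle$ is a spectral space, $g\colon X\to X$ is an order-inverting involution for $\leqslant$, and $U^*:=\{x\in X:g(x)\notin U\}\in\Omega(X)$ for every $U\in\Omega(X)$. For $S\subseteq X^3$ and $U,V\subseteq X$ let $U\circ V=\{z\in X:\exists x,y\,(Sxyz,\ x\in U,\ y\in V)\}$ and $U\rightarrow V=\{x\in X:\forall y,z\,((Sxyz\ \text{and}\ y\in U)\Rightarrow z\in V)\}$. A DMGrp-space is $\langle X;g,S,\Theta,\tau\rangle$, with $S\subseteq X^3$ and $\Theta\subseteq X$, such that: (1) $\langle X;g,\tau\rangle$ is a De Morgan spectral space; (2) $U,V\in\Omega(X)$ implies $U\circ V\in\Omega(X)$ and $U\rightarrow V\in\Omega(X)$; (3) $Sxyz$, $x'\leqslant x$, $y'\leqslant y$, $z\leqslant z'$ imply $Sx'y'z'$; (4) if not $Sxyz$, there are $U,V\in\Omega(X)$ with $x\in U$, $y\in V$, $z\notin U\circ V$; (5) $\Theta\in\Omega(X)$ and for all $y,z$: $y\leqslant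 z$ iff there is $x\in\Theta$ with $Sxyz$. Put $\mathcal{G}_0(X)=\langle\Omega(X);\cap,\cup,{}^*,\circ,\rightarrow,\Theta,\emptyset,X\rangle$. For an algebra $\langle A;\wedge,\vee,-,\cdot,\rightarrow,t,0,1\rangle$ of this type (with bounded distributive lattice reduct), $\mathcal{F}_0(A)=\langle\mathfrak{P}(A);g_A,S_A,\Theta_A,\tau(\beta)\rangle$, where $\mathfrak{P}(A)$ is the set of prime (in particular proper) filters of $A$; $g_A(x)=\{a\in A:-a\notin x\}$; $\Theta_A=\{x\in\mathfrak{P}(A):t\in x\}$; $S_Axyz$ iff $\{c\in A:a\cdot b\leq c\text{ for some }a\in x,\ b\in y\}\subseteq z$; and $\tau(\beta)$ is the topology with basis $\{\phi(a):a\in A\}$, $\phi(a)=\{x\in\mathfrak{P}(A):a\in x\}$. *)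

(* Defs.v *)
From HB Require Import structures.
From mathcomp Require Import all_boot all_order.
From mathcomp Require Import boolp classical_sets filter.
From mathcomp Require Import topology.

Set Implicit Arguments.
Unset Strict Implicit.
Unset Printing Implicit Defensive.

Import Order.TTheory.

Local Open Scope classical_set_scope.

Section Topology.
Context {X : topologicalType}.

Definition compact_opens : set (set X) := [set U | compact U /\ open U].

Definition spec_le (x y : X) : Prop := forall U : set X, open U -> U x -> U y.

(* Filters of the lattice of open sets, as sets of open sets; the case of the
   empty family in [cpf_prime] makes them proper. *)
Record completely_prime_filter (F : set (set X)) : Prop := {
  cpf_open : F `<=` open;
  cpf_nonempty : F !=set0;
  cpf_up : forall U V, F U -> open V -> U `<=` V -> F V;
  cpf_setI : forall U V, F U -> F V -> F (U `&` V);
  cpf_prime : forall B : set (set X), B `<=` open ->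
    F (\bigcup_(U in B) U) -> exists2 U, B U & F U
}.

Definition sober : Prop := forall F : set (set X),
  completely_prime_filter F -> exists x : X, F = [set U | open U /\ U x].

End Topology.

Arguments compact_opens : clear implicits.
Arguments sober : clear implicits.

Definition homeomorphism (X Y : topologicalType) (f : X -> Y) : Prop :=
  continuous f /\
  exists h : Y -> X, [/\ continuous h, cancel f h & cancel h f].

(* [compact_opens] is closed under the empty intersection by
   [spectral_compact]. *)
HB.mixin Record isSpectral X & Topological X := {
  spectral_compact : compact [set: X];
  spectral_T0 : kolmogorov_space X;
  spectral_sober : sober X;
  spectral_setI : setI_closed (compact_opens X);
  spectral_basis : basis (compact_opens X)
}.

#[short(type="spectralType")]
HB.structure Definition Spectral := {X of Topological X & isSpectral X}.

(* The signature <X; g, S, Theta, tau>, without axioms. *)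
HB.mixin Record hasInvolution X & Topological X := {
  gmap : X -> X
}.

#[short(type="gSpaceType")]
HB.structure Definition GSpace := {X of Topological X & hasInvolution X}.

HB.mixin Record hasTernaryRel X & Topological X := {
  Srel : X -> X -> X -> Prop;
  Theta : set X
}.

#[short(type="dmGrpFrameType")]
HB.structure Definition DMGrpFrame := {X of GSpace X & hasTernaryRel X}.

Arguments Theta : clear implicits.

Definition set_star (X : gSpaceType) (U : set X) : set X :=
  [set x | ~ U (gmap x)].

Definition set_fusion (X : dmGrpFrameType) (U V : set X) : set X :=
  [set z | exists x y, [/\ Srel x y z, U x & V y]].

Definition set_imp (X : dmGrpFrameType) (U V : set X) : set X :=
  [set x | forall y z, Srel x y z -> U y -> V z].

HB.mixin Record isDeMorganSpectral X & Spectral X & GSpace X := {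
  gmapK : involutive (gmap : X -> X);
  gmap_anti : forall x y : X, spec_le x y -> spec_le (gmap y) (gmap x);
  star_compact_open : forall U : set X,
    compact_opens X U -> compact_opens X (set_star U)
}.

#[short(type="deMorganSpectralType")]
HB.structure Definition DeMorganSpectral :=
  {X of Spectral X & GSpace X & isDeMorganSpectral X}.

HB.mixin Record isDMGrpSpace X & DeMorganSpectral X & DMGrpFrame X := {
  fusion_compact_open : forall U V : set X,
    compact_opens X U -> compact_opens X V ->
    compact_opens X (set_fusion U V);
  imp_compact_open : forall U V : set X,
    compact_opens X U -> compact_opens X V -> compact_opens X (set_imp U V);
  Srel_mono : forall x y z x' y' z' : X, Srel x y z ->
    spec_le x' x -> spec_le y' y -> spec_le z z' -> Srel x' y' z';
  Srel_separated : forall x y z : X, ~ Srel x y z ->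
    exists U V : set X, [/\ compact_opens X U, compact_opens X V,
      U x, V y & ~ set_fusion U V z];
  Theta_compact_open : compact_opens X (Theta X);
  spec_leE : forall y z : X,
    spec_le y z <-> exists2 x, Theta X x & Srel x y z
}.

#[short(type="dmGrpSpaceType")]
HB.structure Definition DMGrpSpace :=
  {X of DeMorganSpectral X & DMGrpFrame X & isDMGrpSpace X}.

(* Algebras <A; /\, \/, -, ., ->, t, 0, 1>: the lattice part is the bounded
   distributive lattice structure of A.  The De Morgan laws for - (an
   order-reversing involution) are what makes g_A(x) a prime filter for every
   prime filter x, hence g_A a self-map of the spectrum; no law is imposed on
   the remaining operations. *)
HB.mixin Record isDMGrpAlg (d : Order.disp_t) A of Order.TBDistrLattice d A := {
  alg_neg : A -> A;
  alg_mul : A -> A -> A;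
  alg_imp : A -> A -> A;
  alg_t : A;
  alg_negK : involutive alg_neg;
  alg_neg_anti : forall a b : A, (a <= b -> alg_neg b <= alg_neg a)%O
}.

#[short(type="dmGrpAlgType")]
HB.structure Definition DMGrpAlg (d : Order.disp_t) :=
  {A of Order.TBDistrLattice d A & isDMGrpAlg d A}.

Arguments alg_t {d}.

Record prime_filter (d : Order.disp_t) (A : tbDistrLatticeType d) (F : set A) :
    Prop := {
  pf_nonempty : F !=set0;
  pf_up : forall a b, F a -> (a <= b)%O -> F b;
  pf_meet : forall a b, F a -> F b -> F (a `&` b)%O;
  pf_proper : F <> setT;
  pf_prime : forall a b, F (a `|` b)%O -> F a \/ F b
}.

Section G0.
Context (X : dmGrpSpaceType).

Record G0 : Type := MkG0 {
  G0_set : set X;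
  G0_setP : G0_set \in compact_opens X
}.

HB.instance Definition _ := [isSub for G0_set].
HB.instance Definition _ := [Choice of G0 by <:].

Lemma compact_opens_meet : 
  {in compact_opens X &, forall U V, (U `&` V)%O \in compact_opens X}.
Proof.
move=> U V /set_mem cU /set_mem cV; apply/mem_set; exact: spectral_setI.
Qed.

Lemma compact_opens_join : 
  {in compact_opens X &, forall U V, (U `|` V)%O \in compact_opens X}.
Proof.
move=> U V /set_mem[cU oU] /set_mem[cV oV]; apply/mem_set.
by split; [exact: compactU|exact: openU].
Qed.

Lemma compact_opens_bot : (\bot : set X)%O \in compact_opens X.
Proof. by apply/mem_set; split; [exact: compact0|exact: open0]. Qed.

Lemma compact_opens_top : (\top : set X)%O \in compact_opens X.
Proof. by apply/mem_set; split; [exact: spectral_compact|exact: openT]. Qed.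

HB.instance Definition _ := Order.SubChoice_isTBSubLattice.Build
  set_display (set X) (fun U => U \in compact_opens X) set_display G0
  compact_opens_meet compact_opens_join compact_opens_bot compact_opens_top.

Lemma G0_setI (U V : G0) : G0_set (U `&` V)%O = G0_set U `&` G0_set V.
Proof. by []. Qed.

Lemma G0_setU (U V : G0) : G0_set (U `|` V)%O = G0_set U `|` G0_set V.
Proof. by []. Qed.

Lemma G0_set0 : G0_set \bot%O = set0.
Proof. by []. Qed.

Lemma G0_setT : G0_set \top%O = setT.
Proof. by []. Qed.

Lemma G0_meetUl : @left_distributive G0 G0 Order.meet Order.join.
Proof.
move=> U V W; apply: val_inj; exact: setIUl.
Qed.

HB.instance Definition _ :=
  Order.Lattice_Meet_isDistrLattice.Build set_display G0 G0_meetUl.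

Definition G0_neg (U : G0) : G0 :=
  MkG0 (mem_set (star_compact_open _ (set_mem (G0_setP U)))).

Definition G0_mul (U V : G0) : G0 :=
  MkG0 (mem_set (fusion_compact_open _ _ (set_mem (G0_setP U)) (set_mem (G0_setP V)))).

Definition G0_imp (U V : G0) : G0 :=
  MkG0 (mem_set (imp_compact_open _ _ (set_mem (G0_setP U)) (set_mem (G0_setP V)))).

Definition G0_t : G0 := MkG0 (mem_set Theta_compact_open).

Lemma G0_leP (U V : G0) : (U <= V)%O <-> G0_set U `<=` G0_set V.
Proof. by rewrite -Order.le_val; split=> /asboolP. Qed.

Lemma G0_negK : involutive G0_neg.
Proof.
move=> U; apply/val_inj/seteqP; split=> x /=; rewrite /set_star/= gmapK.
  exact: contrapT.
by move=> Ux; apply.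
Qed.

Lemma G0_neg_anti (U V : G0) : (U <= V -> G0_neg V <= G0_neg U)%O.
Proof. by move=> /G0_leP UV; apply/G0_leP => x Vx /UV. Qed.

HB.instance Definition _ := isDMGrpAlg.Build set_display G0
  G0_mul G0_imp G0_t G0_negK G0_neg_anti.

End G0.

Section F0.
Context {d : Order.disp_t} (A : dmGrpAlgType d).

Record F0 : Type := MkF0 {
  F0_set : set A;
  F0_setP : F0_set \in [set F : set A | prime_filter F]
}.

HB.instance Definition _ := [isSub for F0_set].
HB.instance Definition _ := [Choice of F0 by <:].

Lemma F0_prime (x : F0) : prime_filter (F0_set x).
Proof. exact: (set_mem (F0_setP x)). Qed.

Lemma pf_top (F : set A) : prime_filter F -> F \top%O.
Proof. by move=> pF; have [a Fa] := pf_nonempty pF; apply: pf_up Fa (lex1 _). Qed.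

Lemma pf_bot (F : set A) : prime_filter F -> ~ F \bot%O.
Proof.
move=> pF F0; apply: (pf_proper pF); apply/seteqP; split=> // a _.
exact: pf_up pF _ _ F0 (le0x _).
Qed.

Definition phi (a : A) : set F0 := [set x | F0_set x a].

Lemma phi_cover : \bigcup_(U in range phi) U = setT.
Proof.
apply/seteqP; split=> // x _; exists (phi \top%O); first by exists \top%O.
exact: pf_top (F0_prime x).
Qed.

Lemma phi_join (U V : set F0) (x : F0) : range phi U -> range phi V ->
  U x -> V x -> exists W, [/\ range phi W, W x & W `<=` U `&` V].
Proof.
move=> [a _ <-] [b _ <-] xa xb; exists (phi (a `&` b)%O); split.
- by exists (a `&` b)%O.
- exact: pf_meet (F0_prime x) _ _ xa xb.
- move=> y yab; split; apply: (pf_up (F0_prime y) yab).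
  + exact: leIl.
  + exact: leIr.
Qed.

HB.instance Definition _ := isBaseTopological.Build F0 phi_cover phi_join.

Definition F0_gset (x : F0) : set A := [set a | ~ F0_set x (alg_neg a)].

Lemma F0_gset_prime (x : F0) : prime_filter (F0_gset x).
Proof.
have px := F0_prime x.
have neg1 : alg_neg \top%O = \bot%O :> A.
  apply/le_anti; rewrite le0x andbT -[X in (_ <= X)%O]alg_negK.
  exact/alg_neg_anti/lex1.
have neg0 : alg_neg \bot%O = \top%O :> A by rewrite -neg1 alg_negK.
split.
- by exists \top%O; rewrite /F0_gset/= neg1; exact: pf_bot.
- move=> a b xa ab xb; apply: xa; apply: (pf_up px xb).
  exact: alg_neg_anti.
- move=> a b xa xb xab.
  have : F0_set x (alg_neg a `|` alg_neg b)%O.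
    apply: (pf_up px xab); rewrite -[leRHS]alg_negK; apply: alg_neg_anti.
    rewrite lexI; apply/andP; split; rewrite -[leRHS]alg_negK;
      apply: alg_neg_anti; [exact: leUl|exact: leUr].
  by move=> /(pf_prime px)[/xa|/xb].
- move=> gT; have : F0_gset x \bot%O by rewrite gT.
  by apply; rewrite neg0; exact: pf_top.
- move=> a b xab; apply: contrapT => /not_orP[/contrapT xa /contrapT xb].
  apply: xab; apply: (pf_up px (pf_meet px xa xb)).
  rewrite -[leLHS]alg_negK; apply: alg_neg_anti.
  rewrite leUx; apply/andP; split; rewrite -[leLHS]alg_negK;
    apply: alg_neg_anti; [exact: leIl|exact: leIr].
Qed.

Definition F0_g (x : F0) : F0 := MkF0 (mem_set (F0_gset_prime x)).

Definition F0_S (x y z : F0) : Prop :=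
  [set c | exists a b, [/\ F0_set x a, F0_set y b & (alg_mul a b <= c)%O]]
    `<=` F0_set z.

HB.instance Definition _ := hasInvolution.Build F0 F0_g.
HB.instance Definition _ := hasTernaryRel.Build F0 F0_S (phi (alg_t A)).

End F0.

(* Main.v *)
Require Import Defs.
From mathcomp Require Import all_boot all_order.
From mathcomp Require Import boolp classical_sets topology.

(** Stone duality: a point is sent to the prime filter of its compact open
    neighbourhoods, and Srel is recovered because it is separated by fusions of
    compact opens.  Conversely, a prime filter P of compact opens generates a
    filter F of open sets, and sobriety provides the corresponding point once F
    is known to be completely prime.  If a union covers U in P while none of its
    members is in F, then the complements in U of the compact opens outside P
    generate a proper filter; a cluster point of it in the compact set U lies in
    a compact open contained in a member of the union, hence outside P, which is
    absurd. *)

Set Implicit Arguments.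
Unset Strict Implicit.
Unset Printing Implicit Defensive.

Import Order.TTheory.

Local Open Scope classical_set_scope.

Section SpectralSpace.
Context {X : spectralType}.

Lemma compact_open_nbhs (W : set X) (x : X) : open W -> W x ->
  exists K, [/\ compact_opens X K, K x & K `<=` W].
Proof.
move=> oW Wx; have [_ /(_ x W)] := @spectral_basis X.
case; first by apply: open_nbhs_nbhs; split.
by move=> K [cK Kx] KW; exists K.
Qed.

(** Compact opens form a basis, so a neighbourhood of one point missing the other shrinks to a
    compact open set doing the same. *)
Lemma compact_opens_T0 (x y : X) :
  (forall U, compact_opens X U -> U x <-> U y) -> x = y.
Proof.
move=> xy; apply/eqP; apply: contrapT => /negP /(@spectral_T0 X).
have sep (a b : X) (A : set X) : (forall U, compact_opens X U -> U a -> U b) ->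
    A \in nbhs a -> b \in ~` A -> False.
  move=> ab /set_mem; rewrite nbhsE => -[W [oW Wa] WA] /set_mem; apply.
  have [K [cK Ka KW]] := compact_open_nbhs oW Wa.
  by apply: WA; apply: KW; exact: ab cK Ka.
move=> [A [[Ax Ay]|[Ay Ax]]].
- by apply: (sep x y A) => // U cU; apply (xy _ cU).
- by apply: (sep y x A) => // U cU; apply (xy _ cU).
Qed.

End SpectralSpace.

Section PointFilter.
Context {X : dmGrpSpaceType}.

Lemma G0_setCO (U : G0 X) : compact_opens X (G0_set U).
Proof. exact: set_mem (G0_setP U). Qed.

Lemma G0_set_surj (U : set X) :
  compact_opens X U -> exists K : G0 X, G0_set K = U.
Proof. by move=> cU; exists (MkG0 (mem_set cU)). Qed.

Definition point_filter (x : X) : set (G0 X) := [set U | G0_set U x].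

Lemma point_filter_prime (x : X) : prime_filter (point_filter x).
Proof.
split.
- by exists \top%O.
- by move=> U V Ux /G0_leP; apply.
- by move=> U V Ux Vx; split.
- move=> xT; have : point_filter x \bot%O by rewrite xT.
  by [].
- by [].
Qed.

Definition to_F0 (x : X) : F0 (G0 X) := MkF0 (mem_set (point_filter_prime x)).

Lemma to_F0_inj : injective to_F0.
Proof.
move=> x y /(congr1 (@F0_set _ _)) /= xy.
apply: compact_opens_T0 => U /G0_set_surj[K <-].
have : point_filter x K = point_filter y K by rewrite xy.
by rewrite /point_filter /= => ->.
Qed.

Lemma to_F0_Srel (x y z : X) :
  Srel x y z <-> Srel (to_F0 x) (to_F0 y) (to_F0 z).
Proof.
split=> [Sxyz W [U [V [Ux Vy /G0_leP]]]|Sxyz].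
  by apply; exists x, y.
apply: contrapT => /Srel_separated[U' [V' [/G0_set_surj[U <-{U'}]]]].
move=> /G0_set_surj[V <-{V'}] Ux Vy; apply.
(* The product of [U] and [V] bounds itself, so it must belong to the filter of [z], that is, [z]
   lies in the fusion. *)
by apply: (Sxyz (alg_mul U V)); exists U, V.
Qed.

Lemma to_F0_gmap (x : X) : to_F0 (gmap x) = gmap (to_F0 x).
Proof.
apply: val_inj; apply/seteqP; split=> U /=.
  by move=> Ugx; apply.
exact: contrapT.
Qed.

End PointFilter.

Section PrimeFilterPoint.
Context {X : dmGrpSpaceType}.
Variable P : set (G0 X).
Hypothesis pP : prime_filter P.

Definition open_filter : set (set X) :=
  [set W | open W /\ exists2 U, P U & G0_set U `<=` W].

Definition residual_filter (U : G0 X) : set (set X) :=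
  [set A | exists2 K, ~ P K & G0_set U `\` G0_set K `<=` A].

(** If [U] were inside [K], upward closure would put [K] in [P]. Primeness gives intersections:
    removing [K] and [L] removes their join, still outside [P]. *)
Lemma residual_filter_proper (U : G0 X) :
  P U -> ProperFilter (residual_filter U).
Proof.
move=> PU; split.
  move=> [K PK UK]; apply: PK; apply: (pf_up pP PU); apply/G0_leP => x Ux.
  by apply: contrapT => Kx; apply: (UK x).
split.
- by exists \bot%O => //; exact: pf_bot.
- move=> A B [K PK KA] [L PL LB]; exists (K `|` L)%O.
    by move=> /(pf_prime pP)[].
  rewrite G0_setU => x [Ux /not_orP[Kx Lx]].
  by split; [exact: KA|exact: LB].
- by move=> A B AB [K PK KA]; exists K => //; exact: subset_trans AB.
Qed.

Lemma open_filter_cpf : completely_prime_filter open_filter.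
Proof.
split.
- by move=> W [].
- exists setT; split; first exact: openT.
  by have [U PU] := pf_nonempty pP; exists U.
- move=> U V [_ [K PK KU]] oV UV; split=> //.
  by exists K => //; exact: subset_trans UV.
- move=> U V [oU [K PK KU]] [oV [L PL LV]]; split; first exact: openI.
  exists (K `&` L)%O; first exact: pf_meet pP _ _ PK PL.
  by rewrite G0_setI; exact: setISS.
- move=> B oB [_ [U PU UB]]; apply: contrapT => noB.
  have resF := residual_filter_proper PU.
  have resU : residual_filter U (G0_set U).
    by exists \bot%O; [exact: pf_bot|exact: subDsetl].
  have [cU _] := G0_setCO U.
  have [u [Uu clu]] := cU _ resF resU.
  have [W BW Wu] := UB u Uu.
  have [_ [/G0_set_surj[K <-] Ku KW]] := compact_open_nbhs (oB _ BW) Wu.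
  (* Otherwise [K] would witness that [W], a member of the cover, is in [open_filter]. *)
  have PK : ~ P K.
    move=> PK; apply: noB; exists W => //.
    by split; [exact: oB|exists K].
  have resK : residual_filter U (G0_set U `\` G0_set K) by exists K.
  have nKu : nbhs u (G0_set K).
    by apply: open_nbhs_nbhs; split=> //; have [] := G0_setCO K.
  (* The cluster point forces [K] to meet its own complement in [U]. *)
  by have [v [[_]]] := clu _ _ resK nKu.
Qed.

(** Passing to [open_filter] adds no compact opens: one containing a member of [P] is already in
    [P]. *)
Lemma prime_filter_point : exists x : X, P = point_filter x.
Proof.
have [x Fx] := @spectral_sober X _ open_filter_cpf.
exists x; apply/seteqP; split=> U.
  move=> PU; suff : open_filter (G0_set U) by rewrite Fx => -[].
  by split; [have [] := G0_setCO U|exists U].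
move=> Ux; have : open_filter (G0_set U).
  by rewrite Fx; split=> //; have [] := G0_setCO U.
by move=> [_ [V PV /G0_leP VU]]; exact: pf_up pP _ _ PV VU.
Qed.

End PrimeFilterPoint.

Section Homeomorphism.

Lemma open_phi (d : Order.disp_t) (A : dmGrpAlgType d) (a : A) : open (phi a).
Proof.
exists [set phi a]; last exact: bigcup_set1.
by move=> _ ->; exists a.
Qed.

Lemma phi_baseP (d : Order.disp_t) (A : dmGrpAlgType d) (W : set (F0 A)) :
  open W -> exists2 D, D `<=` range (@phi d A) & \bigcup_(U in D) U = W.
Proof. by []. Qed.

Context {X : dmGrpSpaceType}.

Lemma to_F0_surj (p : F0 (G0 X)) : exists x : X, to_F0 x = p.
Proof.
have [x px] := prime_filter_point (F0_prime p).
by exists x; apply: val_inj.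
Qed.

(** The preimage of [phi U] is [U] itself. *)
Lemma to_F0_continuous : continuous (@to_F0 X).
Proof.
apply/continuousP => _ /phi_baseP[D Dphi <-]; rewrite preimage_bigcup.
apply: bigcup_open => _ /Dphi[U _ <-].
by have [] := G0_setCO U.
Qed.

Lemma to_F0_homeomorphism : homeomorphism (@to_F0 X).
Proof.
split; first exact: to_F0_continuous.
have [h hK] := choice to_F0_surj.
have Kh : cancel to_F0 h by move=> x; apply: to_F0_inj; rewrite hK.
exists h; split=> //; apply/continuousP => W oW.
(* [W] is the union of the compact opens inside it, and [h] pulls each such [U] back to [phi U]. *)
suff -> : h @^-1` W = \bigcup_(U in [set U : G0 X | G0_set U `<=` W]) phi U.
  by apply: bigcup_open => U _; exact: open_phi.
apply/seteqP; split=> p /=.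
  move=> /(compact_open_nbhs oW)[_ [/G0_set_surj[U <-] Uhp UW]].
  by exists U => //; rewrite -(hK p).
by move=> [U UW]; rewrite -{1}(hK p); exact: UW.
Qed.

End Homeomorphism.

Theorem theorem4p10 (X : dmGrpSpaceType) :
  exists f : X -> F0 (G0 X),
    [/\ homeomorphism f,
        forall x : X, f (gmap x) = gmap (f x),
        forall x y z : X, Srel x y z <-> Srel (f x) (f y) (f z)
      & forall x : X, Theta X x <-> Theta (F0 (G0 X)) (f x)].
Proof.
exists to_F0; split.
- exact: to_F0_homeomorphism.
- exact: to_F0_gmap.
- exact: to_F0_Srel.
(* The unit of the algebra is [Theta X], so both sides are convertible. *)
- by [].
Qed.
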